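(* Let $U\subset\mathbb R^n$ be a smooth bounded domain and $H:\mathbb R^n\to\mathbb R$ satisfy: (H1) $H$ is smooth and $H(0)<0$; (H2) $\lim_{|p|\to\infty}H(p)/|p|=\infty$; (H3) there exist $\gamma,\delta>0$ with $DH(p)\cdot p-\gamma H(p)\ge\delta$ for all $p\in\mathbb R^n$. For $0<\epsilon<1$ let $u^{\epsilon}$ be the solution of $H(Du^{\epsilon})=\epsilon\Delta u^{\epsilon}$ in $U$, $u^{\epsilon}=0$ on $\partial U$. Then there is a constant $C$ independent of $\epsilon$ such that $\|u^{\epsilon}\|_{L^\infty(U)}\le C$ and $\|Du^{\epsilon}\|_{L^\infty(U)}\le C$. *)

(* Defs.v *)
From HB Require Import structures.
From mathcomp Require Import all_boot all_order all_algebra.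
From mathcomp Require Import all_classical all_reals all_analysis.
Set Implicit Arguments. Unset Strict Implicit. Unset Printing Implicit Defensive.
Import Order.TTheory GRing.Theory Num.Theory.
Import numFieldNormedType.Exports.
Local Open Scope classical_set_scope.
Local Open Scope ring_scope.

Section Defs.
Variable R : realType.

Definition ebasis {n : nat} (i : 'I_n) : 'rV[R]_n := delta_mx 0 i.

Definition edot {n : nat} (p q : 'rV[R]_n) : R := \sum_(i < n) p 0 i * q 0 i.
Definition enorm {n : nat} (p : 'rV[R]_n) : R := Num.sqrt (edot p p).

Definition partial {n : nat} (i : 'I_n) (f : 'rV[R]_n -> R) (x : 'rV[R]_n) : R :=
  derive f x (ebasis i).

Definition grad {n : nat} (f : 'rV[R]_n -> R) (x : 'rV[R]_n) : 'rV[R]_n :=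
  \row_(i < n) partial i f x.

Definition laplacian {n : nat} (f : 'rV[R]_n -> R) (x : 'rV[R]_n) : R :=
  \sum_(i < n) partial i (partial i f) x.

Fixpoint Ck_on {n : nat} (k : nat) (U : set 'rV[R]_n) (f : 'rV[R]_n -> R) : Prop :=
  match k with
  | 0 => forall x, U x -> {for x, continuous f}
  | k'.+1 => (forall x, U x -> {for x, continuous f}) /\
             (forall x, U x -> forall i, derivable f x (ebasis i)) /\
             (forall i, Ck_on k' U (partial i f))
  end.

Definition smooth_on {n : nat} (U : set 'rV[R]_n) (f : 'rV[R]_n -> R) : Prop :=
  forall k, Ck_on k U f.

Definition bounded_set {n : nat} (U : set 'rV[R]_n) : Prop :=
  exists M : R, forall x, U x -> enorm x <= M.

Definition bdry {n : nat} (U : set 'rV[R]_n) : set 'rV[R]_n := closure U `\` interior U.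

(* A bounded domain (open, connected, nonempty, bounded) in R^(1+m) with smooth
   boundary, in the sense of Evans: near each boundary point x0, after a rigid
   change of coordinates (orthogonal Q), U is the region above the graph of a
   smooth function gamma : R^m -> R. *)
Definition smooth_bounded_domain {m : nat} (U : set 'rV[R]_(1 + m)) : Prop :=
  open U /\ connected U /\ U !=set0 /\ bounded_set U /\
  forall x0, bdry U x0 ->
    exists (r : R) (Q : 'M[R]_(1 + m)) (gamma : 'rV[R]_m -> R),
      0 < r /\ Q *m Q^T = 1%:M /\ smooth_on setT gamma /\
      forall x, ball x0 r x ->
        (U x <-> (let y := (x - x0) *m Q in lsubmx y 0 0 > gamma (rsubmx y))).

Definition H1 {n : nat} (H : 'rV[R]_n -> R) : Prop :=
  smooth_on setT H /\ H 0 < 0.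

Definition H2 {n : nat} (H : 'rV[R]_n -> R) : Prop :=
  forall M : R, exists R0 : R, forall p, R0 < enorm p -> M < H p / enorm p.

Definition H3 {n : nat} (H : 'rV[R]_n -> R) : Prop :=
  exists gamma delta : R, 0 < gamma /\ 0 < delta /\
    forall p, edot (grad H p) p - gamma * H p >= delta.

Definition is_solution {n : nat} (H : 'rV[R]_n -> R) (eps : R)
    (U : set 'rV[R]_n) (u : 'rV[R]_n -> R) : Prop :=
  Ck_on 2 U u /\
  {within closure U, continuous u} /\
  (forall x, bdry U x -> u x = 0) /\
  (forall x, U x -> H (grad u x) = eps * laplacian u x).

End Defs.

(* Main.v *)
Require Import Defs.
From HB Require Import structures.
From mathcomp Require Import all_boot all_order all_algebra.
From mathcomp Require Import all_classical all_reals all_analysis.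
From mathcomp Require Import ring lra.
Import Order.TTheory GRing.Theory Num.Theory.
Import numFieldNormedType.Exports.
Local Open Scope classical_set_scope.
Local Open Scope ring_scope.

(** A ball [B(z + N, |N|)] lying outside [U] and touching it at [z] gives the
    barrier [M (|x - z - N|^2 - |N|^2)]: by superlinearity of [H] it is a strict
    supersolution for [M] large, whatever [eps < 1] is, so [u <= C |x - z|] with
    [C] uniform in [z] by compactness of the boundary; [0] is a strict
    subsolution because [H 0 < 0], so [u >= 0]. As [H] does not depend on [x],
    the translates of [u] solve the same equation, and comparing [u] with
    [u (. + h)] carries the boundary estimate to [u (x + h) - u x <= C |h|]
    inside [U]; this only uses second derivatives of [u]. *)

(** * The Euclidean product against the sup norm [|p|], and derivatives along lines *)

Section Coordinates.
Context {R : realType} {n : nat}.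
Implicit Types p q x y z : 'rV[R]_n.

Lemma coord_le_norm p i : `|p 0 i| <= `|p|.
Proof.
by rewrite [leRHS]/Num.Def.normr /= mx_normrE; apply/bigmax_geP; right => /=; exists (0, i).
Qed.

Lemma norm_le_coord p (c : R) : 0 <= c -> (forall i, `|p 0 i| <= c) -> `|p| <= c.
Proof.
move=> c0 pc; rewrite [leLHS]/Num.Def.normr /= mx_normrE; apply/bigmax_leP; split => //=.
by move=> [a i] _ /=; rewrite (ord1 a).
Qed.

Lemma edotC p q : edot p q = edot q p.
Proof. by apply: eq_bigr => i _; rewrite mulrC. Qed.

Lemma edotDl p q z : edot (p + q) z = edot p z + edot q z.
Proof. by rewrite -big_split; apply: eq_bigr => i _; rewrite mxE mulrDl. Qed.

Lemma edotZl (a : R) p z : edot (a *: p) z = a * edot p z.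
Proof. by rewrite /edot mulr_sumr; apply: eq_bigr => i _; rewrite mxE mulrA. Qed.

Lemma edotDr p q z : edot z (p + q) = edot z p + edot z q.
Proof. by rewrite edotC edotDl !(edotC z). Qed.

Lemma edotZr (a : R) p z : edot z (a *: p) = a * edot z p.
Proof. by rewrite edotC edotZl edotC. Qed.

Lemma edotNl p z : edot (- p) z = - edot p z.
Proof. by rewrite -scaleN1r edotZl mulN1r. Qed.

Lemma edotNr p z : edot z (- p) = - edot z p.
Proof. by rewrite edotC edotNl edotC. Qed.

Lemma edot_ge0 p : 0 <= edot p p.
Proof. by apply: sumr_ge0 => i _; rewrite -expr2 sqr_ge0. Qed.

Lemma sqr_norm_le_edot p : `|p| ^+ 2 <= edot p p.
Proof.
rewrite -(sqr_sqrtr (edot_ge0 p)) ler_sqr ?nnegrE ?sqrtr_ge0//.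
apply: norm_le_coord => [|i]; first exact: sqrtr_ge0.
rewrite -sqrtr_sqr ler_wsqrtr// /edot (bigD1 i)//= -expr2 lerDl.
by apply: sumr_ge0 => j _; rewrite -expr2 sqr_ge0.
Qed.

Lemma norm_le_enorm p : `|p| <= enorm p.
Proof.
rewrite -(@ler_sqr _ `|p|) ?nnegrE ?sqrtr_ge0// sqr_sqrtr ?edot_ge0//.
exact: sqr_norm_le_edot.
Qed.

Lemma edot_le_norm p q : `|edot p q| <= n%:R * (`|p| * `|q|).
Proof.
rewrite /edot (le_trans (ler_norm_sum _ _ _))//.
apply: (@le_trans _ _ (\sum_(i < n) `|p| * `|q|)).
  by apply: ler_sum => i _; rewrite normrM ler_pM// coord_le_norm.
by rewrite sumr_const card_ord mulr_natl.
Qed.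

Lemma edot_trmx p q (Q : 'M[R]_n) : edot (p *m Q) q = edot p (q *m Q^T).
Proof.
have edotE a b : edot a b = (a *m b^T) 0 0.
  by rewrite !mxE; apply: eq_bigr => i _; rewrite mxE.
by rewrite !edotE trmx_mul trmxK mulmxA.
Qed.

(** Both sides have the same difference quotient. This brings one-variable calculus to bear on
    partial derivatives. *)
Lemma is_derive_line (f : 'rV[R]_n -> R) x v t d :
  is_derive (t *: v + x) v f d <-> is_derive t 1 (fun s : R => f (s *: v + x)) d.
Proof.
have E : (fun h : R => h^-1 *: (f (h *: v + (t *: v + x)) - f (t *: v + x))) =
  (fun h : R => h^-1 *: ((fun s : R => f (s *: v + x)) (h *: (1 : R) + t)
     - f (t *: v + x))).
  by apply/funext => h; rewrite /= [h%:A]mulr1 scalerDl addrA.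
split => -[].
  move=> D1 D2; split; first by move: D1; rewrite /derivable E.
  by move: D2; rewrite /derive E.
move=> D1 D2; split; first by move: D1; rewrite /derivable E.
by move: D2; rewrite /derive E.
Qed.

Lemma is_derive_translate (f : 'rV[R]_n -> R) x h v d :
  is_derive (x + h) v f d -> is_derive x v (fun y => f (y + h)) d.
Proof.
move=> D; suff : is_derive (0 *: v + x) v (fun y => f (y + h)) d by rewrite scale0r add0r.
apply/is_derive_line; under eq_fun do rewrite -addrA.
by apply/is_derive_line; rewrite scale0r add0r.
Qed.

End Coordinates.

(** * First and second order conditions at an interior maximum *)

Section SecondOrder.
Context {R : realType}.

(** If [q > 0], then [p], which vanishes at [0], is positive just to the right of [0], and the mean
    value theorem gives some [g t > g 0]. The second derivative is required at the single point
    [0]. *)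
Lemma max_derive2 (g p : R -> R) (q e : R) : 0 < e ->
  (forall t, `|t| < e -> is_derive t (1 : R) g (p t)) -> is_derive (0 : R) (1 : R) p q ->
  (forall t, `|t| < e -> g t <= g 0) -> p 0 = 0 /\ q <= 0.
Proof.
move=> e0 dg dp gmax.
have inI t : t \in `]-e, e[ -> `|t| < e by rewrite in_itv /= ltr_norml.
have p0 : p 0 = 0.
  have [d1 d2] : is_derive (0 : R) (1 : R) g 0.
    apply: (@derive1_at_max _ g (- e) e 0); first lra.
    - by move=> t /inI/dg[].
    - by rewrite in_itv /=; apply/andP; split; lra.
    - by move=> t /inI/gmax.
  by have [_ <-] : is_derive (0 : R) (1 : R) g (p 0) by apply: dg; rewrite normr0.
split => //; rewrite leNgt; apply/negP => q0.
have [dp1 dp2] := dp.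
have C : (fun h : R => h^-1 *: (p (h *: (1 : R) + 0) - p 0)) @ 0^' --> q.
  by rewrite -dp2; exact: dp1.
have := cvgr_gt _ C _ q0.
move=> /(_ _)/= /nbhs_ballP[d /= d0 Hd].
pose t := Num.min d e / 2.
have m0 : 0 < Num.min d e by rewrite lt_min d0.
have t0 : 0 < t by rewrite /t divr_gt0.
have [td te] : t < d /\ t < e.
  have : t < Num.min d e by rewrite /t; lra.
  by rewrite lt_min => /andP[].
have ppos s : 0 < s -> s <= t -> 0 < p s.
  move=> s0 st.
  have := Hd s; rewrite /ball /= sub0r normrN gtr0_norm// => /(_ (le_lt_trans st td)).
  move=> /(_ (lt0r_neq0 s0)); rewrite [_%:A]mulr1 addr0 p0 subr0 pmulr_rgt0//.
  by rewrite invr_gt0.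
have [c + gc] : exists2 c, c \in `]0, t[ & g t - g 0 = p c * (t - 0).
  apply: MVT => //.
    move=> x /[!in_itv]/= /andP[x0 xt]; apply: dg.
    by rewrite gtr0_norm// (lt_trans xt).
  apply: derivable_within_continuous => x /[!in_itv]/= /andP[x0 xt].
  by case: (dg x) => //; rewrite ger0_norm// (le_lt_trans xt).
rewrite in_itv /= => /andP[c0 ct].
have := gmax t; rewrite gtr0_norm// => /(_ te).
by rewrite -subr_le0 gc subr0 leNgt mulr_gt0// ppos// ltW.
Qed.

Context {n : nat}.

(** Only pure second derivatives are recorded, as the Laplacian involves no others. Carrying [P] and
    [Q] explicitly keeps the derivatives of sums and translates in closed form. *)
Definition has_partials2 (V : set 'rV[R]_n) (f : 'rV[R]_n -> R)
    (P Q : 'I_n -> 'rV[R]_n -> R) :=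
  forall x, V x -> forall i, is_derive x (ebasis R i) f (P i x) /\
                             is_derive x (ebasis R i) (P i) (Q i x).

Lemma has_partials2B V f g P Q P' Q' :
  has_partials2 V f P Q -> has_partials2 V g P' Q' ->
  has_partials2 V (fun x => f x - g x) (fun i x => P i x - P' i x)
    (fun i x => Q i x - Q' i x).
Proof.
move=> hf hg x Vx i; have [a b] := hf x Vx i; have [c d] := hg x Vx i.
by split; apply: is_deriveB.
Qed.

Lemma has_partials2D V f g P Q P' Q' :
  has_partials2 V f P Q -> has_partials2 V g P' Q' ->
  has_partials2 V (fun x => f x + g x) (fun i x => P i x + P' i x)
    (fun i x => Q i x + Q' i x).
Proof.
move=> hf hg x Vx i; have [a b] := hf x Vx i; have [c d] := hg x Vx i.
by split; apply: is_deriveD.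
Qed.

Lemma has_partials2N V f P Q :
  has_partials2 V f P Q ->
  has_partials2 V (fun x => - f x) (fun i x => - P i x) (fun i x => - Q i x).
Proof.
by move=> hf x Vx i; have [a b] := hf x Vx i; split; apply: is_deriveN.
Qed.

Lemma has_partials2_translate V f P Q h :
  has_partials2 V f P Q ->
  has_partials2 [set x | V (x + h)] (fun x => f (x + h))
    (fun i x => P i (x + h)) (fun i x => Q i (x + h)).
Proof.
move=> hf x Vx i; have [a b] := hf _ Vx i.
by split; apply: is_derive_translate.
Qed.

Lemma has_partials2S V W f P Q : V `<=` W ->
  has_partials2 W f P Q -> has_partials2 V f P Q.
Proof. by move=> VW hf x /VW Vx i; exact: hf. Qed.

Lemma Ck_on_has_partials2 V (f : 'rV[R]_n -> R) : Ck_on 2 V f ->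
  has_partials2 V f (fun i => partial i f) (fun i => partial i (partial i f)).
Proof.
move=> [_ [df pf]] x Vx i; split; first exact/derivableP/df.
by have [_ [dpf _]] := pf i; apply/derivableP/dpf.
Qed.

(** Each coordinate line through [x] stays in [V] for a short time, so the one-variable test applies
    to the restriction of [f]. *)
Lemma has_partials2_max V f P Q x : open V -> V x -> has_partials2 V f P Q ->
  (forall y, V y -> f y <= f x) -> forall i, P i x = 0 /\ Q i x <= 0.
Proof.
move=> oV Vx hf fmax i.
have : \forall t \near (0 : R), V (t *: ebasis R i + x).
  have C : (fun t : R => t *: ebasis R i + x) @ 0 --> (0 *: ebasis R i + x : 'rV[R]_n).
    apply: cvgD; last exact: cvg_cst.
    by apply: cvgZr_tmp; exact: cvg_id.
  by rewrite scale0r add0r in C; apply: C; exact: open_nbhs_nbhs.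
move=> /nbhs_ballP[e /= e0 He].
have HV t : `|t| < e -> V (t *: ebasis R i + x).
  by move=> te; apply: He; rewrite /ball /= sub0r normrN.
have := @max_derive2 (fun t => f (t *: ebasis R i + x))
  (fun t => P i (t *: ebasis R i + x)) (Q i x) e e0.
rewrite scale0r add0r; apply.
- by move=> t /HV/hf/(_ i)[/is_derive_line].
- by apply/is_derive_line; rewrite scale0r add0r; case: (hf x Vx i).
- by move=> t /HV/fmax.
Qed.

End SecondOrder.

(** * Lipschitz and Taylor estimates from bounds on partial derivatives *)

Section MeanValue.
Context {R : realType}.

(** The increment [d] may have either sign, as the coordinate differences of two points do. *)
Lemma MVT_from0 (g dg : R -> R) (d : R) :
  (forall t, `|t| <= `|d| -> is_derive t (1 : R) g (dg t)) ->
  exists2 t, `|t| <= `|d| & g d - g 0 = dg t * d.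
Proof.
move=> dgP; have [d0|/ltW d0] := leP 0 d.
  have H t : t \in `[0, d] -> `|t| <= `|d|.
    by rewrite in_itv /= => /andP[t0 td]; rewrite !ger0_norm.
  have [t tI E] : exists2 t, t \in `[0, d] & g d - g 0 = dg t * (d - 0).
    apply: MVT_segment => //; first by move=> x /subset_itv_oo_cc/H/dgP.
    by apply: derivable_within_continuous => x /H/dgP[].
  by exists t; rewrite ?H// E subr0.
have H t : t \in `[d, 0] -> `|t| <= `|d|.
  by rewrite in_itv /= => /andP[t0 td]; rewrite !ler0_norm// lerN2.
have [t tI E] : exists2 t, t \in `[d, 0] & g 0 - g d = dg t * (0 - d).
  apply: MVT_segment => //; first by move=> x /subset_itv_oo_cc/H/dgP.
  by apply: derivable_within_continuous => x /H/dgP[].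
by exists t; [exact: H|rewrite -opprB E sub0r mulrN opprK].
Qed.

Context {n : nat}.
Implicit Types (x y z : 'rV[R]_n) (f : 'rV[R]_n -> R).

(* Travel from [z] to [x] changing one coordinate at a time: the path stays in
   the coordinate box, and only partial derivatives are needed. *)
Lemma coord_MVT f (c : 'I_n -> R) (k : R) x z :
  (forall y, (forall j, `|y 0 j - z 0 j| <= `|x 0 j - z 0 j|) ->
     forall i, derivable f y (ebasis R i) /\ `|partial i f y - c i| <= k) ->
  `|f x - f z - \sum_i c i * (x 0 i - z 0 i)| <= k * \sum_i `|x 0 i - z 0 i|.
Proof.
move=> H.
pose p (l : nat) : 'rV[R]_n := \row_j (if (j < l)%N then x 0 j else z 0 j).
have -> : f x - f z = \sum_(i < n) (f (p i.+1) - f (p i)).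
  rewrite -(big_mkord xpredT (fun i => f (p i.+1) - f (p i))) telescope_sumr//.
  by congr (f _ - f _); apply/rowP => j; rewrite mxE ?ltn_ord ?ltn0.
rewrite -sumrB (le_trans (ler_norm_sum _ _ _))// mulr_sumr.
apply: ler_sum => i _.
set d := x 0 i - z 0 i.
have pS : p i.+1 = d *: ebasis R i + p i.
  apply/rowP => j; rewrite !mxE eqxx /= ltnS leq_eqVlt.
  have [->|ji] := eqVneq j i; first by rewrite eqxx ltnn /= mulr1 /d subrK.
  by rewrite (_ : (j == i :> nat) = false) ?mulr0 ?add0r//; apply/negbTE.
have inbox t : `|t| <= `|d| ->
    forall j, `|(t *: ebasis R i + p i) 0 j - z 0 j| <= `|x 0 j - z 0 j|.
  move=> td j; rewrite !mxE eqxx /=; have [->|ji] := eqVneq j i.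
    by rewrite ltnn mulr1 addrK.
  by rewrite mulr0 add0r; case: ifP => // _; rewrite subrr normr0.
have [t td E] := @MVT_from0 (fun t => f (t *: ebasis R i + p i))
  (fun t => partial i f (t *: ebasis R i + p i)) d
  (fun t td => (is_derive_line _ _ _ _ _).1 (derivableP (H _ (inbox t td) i).1)).
move: E; rewrite -pS scale0r add0r => ->.
rewrite -mulrBl normrM ler_wpM2r//.
by have [_] := H _ (inbox t td) i.
Qed.

Lemma closed_norm_le (B : R) : closed [set x : 'rV[R]_n | `|x| <= B].
Proof.
apply: (@preimage_closed _ _ (fun x : 'rV[R]_n => `|x|) [set r | r <= B]).
  by move=> x _; exact: norm_continuous.
exact: closed_le.
Qed.

Lemma compact_norm_le (B : R) : compact [set x : 'rV[R]_n | `|x| <= B].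
Proof.
apply: bounded_closed_compact; last exact: closed_norm_le.
exists B; split; first exact: num_real.
by move=> M BM x /= xB; rewrite (le_trans xB)// ltW.
Qed.

Lemma compact_family_bound {m : nat} (K : set 'rV[R]_n) (F : 'I_m -> 'rV[R]_n -> R) :
  compact K -> (forall i x, K x -> {for x, continuous (F i)}) ->
  exists2 M : R, 0 <= M & forall i x, K x -> `|F i x| <= M.
Proof.
move=> cK cF.
have bF i : exists M : R, 0 <= M /\ forall x, K x -> `|F i x| <= M.
  have cFK : {within K, continuous (F i)}.
    by apply: continuous_in_subspaceT => x /set_mem Kx; exact: cF.
  have [M [_ HM]] := compact_bounded (continuous_compact cFK cK).
  exists (`|M| + 1); split; first by rewrite addr_ge0.
  move=> x Kx; apply: HM; last by exists x.
  by rewrite (le_lt_trans (ler_norm M))// ltrDl.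
have [M HM] := choice bF.
exists (\sum_i M i); first by apply: sumr_ge0 => i _; case: (HM i).
move=> i x Kx; rewrite (le_trans ((HM i).2 x Kx))// (bigD1 i)//= lerDl.
by apply: sumr_ge0 => j _; case: (HM j).
Qed.

Lemma box_norm_le x y z (B : R) :
  (forall j, `|y 0 j - z 0 j| <= `|x 0 j - z 0 j|) ->
  `|x| <= B -> `|z| <= B -> `|y| <= B *+ 3.
Proof.
move=> yxz xB zB; have B0 : 0 <= B by exact: le_trans (normr_ge0 x) xB.
apply: norm_le_coord => [|j]; first by rewrite mulrn_wge0.
have := ler_normB (x 0 j) (z 0 j).
have := ler_normD (y 0 j - z 0 j) (z 0 j); rewrite subrK.
have := coord_le_norm x j; have := coord_le_norm z j; have := yxz j.
by rewrite mulrSr mulr2n; lra.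
Qed.

(** This is [coord_MVT] with [c = 0]. The path from [z] to [x] may leave the ball of radius [B] but
    not the one of radius [3 B], where compactness bounds the partial derivatives. *)
Lemma C1_lipschitz {m : nat} (F : 'I_m -> 'rV[R]_n -> R) (B : R) :
  (forall a, Ck_on 1 setT (F a)) ->
  exists2 L : R, 0 <= L & forall a x z, `|x| <= B -> `|z| <= B ->
    `|F a x - F a z| <= L * \sum_i `|x 0 i - z 0 i|.
Proof.
move=> C1F.
have bd a : exists L : R, 0 <= L /\ forall i x, `|x| <= B *+ 3 -> `|partial i (F a) x| <= L.
  have [|L L0 HL] := @compact_family_bound n _ (fun i => partial i (F a))
    (compact_norm_le (B *+ 3)).
    by move=> i x _; have [_ [_ /(_ i)]] := C1F a; apply.
  by exists L.
have [L HL] := choice bd.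
have sL a : L a <= \sum_a L a.
  by rewrite (bigD1 a)//= lerDl; apply: sumr_ge0 => j _; case: (HL j).
exists (\sum_a L a); first by apply: sumr_ge0 => a _; case: (HL a).
move=> a x z xB zB.
have := @coord_MVT (F a) (fun=> 0) (\sum_a L a) x z.
rewrite [X in _ - X]big1 => [|i _]; last by rewrite mul0r.
rewrite subr0; apply => y ybox i; have [_ [df _]] := C1F a; split; first exact: df.
rewrite subr0 (le_trans _ (sL a))//; apply: (HL a).2.
exact: box_norm_le ybox xB zB.
Qed.

(** This is [coord_MVT] with [c] the gradient at [z]: along the path the partial derivatives deviate
    from it by at most their Lipschitz constant times the distance, hence the square. *)
Lemma C2_taylor1 f (B : R) : Ck_on 2 setT f ->
  exists2 L : R, 0 <= L & forall x z, `|x| <= B -> `|z| <= B ->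
    `|f x - f z - \sum_i partial i f z * (x 0 i - z 0 i)|
      <= L * (\sum_i `|x 0 i - z 0 i|) ^+ 2.
Proof.
move=> [_ [df C1]].
have [L L0 HL] := @C1_lipschitz _ (fun i => partial i f) (B *+ 3) C1.
exists L => // x z xB zB; rewrite expr2 mulrA.
apply: (@coord_MVT f (fun i => partial i f z)) => y ybox i; split; first exact: df.
have yB : `|y| <= B *+ 3 by exact: box_norm_le ybox xB zB.
have zB3 : `|z| <= B *+ 3.
  by rewrite (le_trans zB)// mulrS lerDl mulrn_wge0// (le_trans _ zB).
by rewrite (le_trans (HL i y z yB zB3))// ler_wpM2l// ler_sum.
Qed.

End MeanValue.

(** * Comparison of solutions with zero and with quadratic barriers *)

Section Barriers.
Context {R : realType} {n : nat}.
Implicit Types (x y z : 'rV[R]_n) (U : set 'rV[R]_n) (u H : 'rV[R]_n -> R).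

Lemma closure_norm_le U (B : R) :
  (forall x, U x -> `|x| <= B) -> forall x, closure U x -> `|x| <= B.
Proof.
move=> UB x; have := @closureS _ U [set x | `|x| <= B] UB.
by have /closure_id <- := @closed_norm_le R n B; apply.
Qed.

Lemma compact_closure U (B : R) :
  (forall x, U x -> `|x| <= B) -> compact (closure U).
Proof.
move=> /closure_norm_le UB; apply: subclosed_compact (compact_norm_le B) _ => //.
exact: closed_closure.
Qed.

Lemma bdryP U x : open U -> closure U x -> ~ U x -> bdry U x.
Proof. by move=> /interior_id oU cx nx; split; rewrite ?oU. Qed.

Lemma edot_ebasisl i x : edot (ebasis R i) x = x 0 i.
Proof.
rewrite /edot (bigD1 i)//= big1 ?addr0; first by rewrite mxE !eqxx mul1r.
by move=> j ji; rewrite mxE eqxx /= (negbTE ji) mul0r.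
Qed.

Lemma is_derive_coord i j x :
  is_derive x (ebasis R i) (fun x : 'rV[R]_n => x 0 j) (j == i)%:R.
Proof.
suff : is_derive (0 *: ebasis R i + x) (ebasis R i) (fun x : 'rV[R]_n => x 0 j) (j == i)%:R.
  by rewrite scale0r add0r.
apply/is_derive_line.
rewrite (_ : (fun s : R => _) = (fun s : R => (j == i)%:R *: s + x 0 j)).
  by apply: is_derive_eq; rewrite addr0 [LHS]mulr1.
by apply/funext => s; rewrite !mxE eqxx /= mulrC.
Qed.

Lemma quadratic_partials2 y (M s : R) :
  has_partials2 setT (fun x => M * (edot (x - y) (x - y) - s))
    (fun i x => M * (2 * (x 0 i - y 0 i))) (fun=> fun=> M * 2).
Proof.
move=> x _ i; split; last first.
  rewrite (_ : (fun x : 'rV[R]_n => _) = (fun x => (M * 2) *: (x 0 i - y 0 i))); last first.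
    by apply/funext => w; rewrite mulrA.
  have D := is_derive_coord i i x; rewrite eqxx in D.
  by apply: is_derive_eq; rewrite subr0 [LHS]mulr1.
suff : is_derive (0 *: ebasis R i + x) (ebasis R i)
    (fun x => M * (edot (x - y) (x - y) - s)) (M * (2 * (x 0 i - y 0 i))).
  by rewrite scale0r add0r.
apply/is_derive_line.
rewrite (_ : (fun t : R => _) = (fun t : R => M *: (t ^+ 2 +
   ((2 * (x 0 i - y 0 i)) *: t + (edot (x - y) (x - y) - s))))).
  apply: is_derive_eq; rewrite /GRing.scale /=. ring.
have -> : x 0 i - y 0 i = (x - y) 0 i by rewrite !mxE.
apply/funext => t; rewrite -addrA; move: (x - y) => w.
rewrite edotDl !edotDr (edotC w) !edotZl edotZr !edot_ebasisl mxE !eqxx.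
by rewrite /GRing.scale /=; ring.
Qed.

Lemma continuous_sqr_dist y : continuous (fun x => edot (x - y) (x - y)).
Proof.
have cd i : continuous (fun x : 'rV[R]_n => (x - y) 0 i).
  under eq_fun do rewrite mxE.
  move=> w; apply: (@continuousD _ _ _ (fun x : 'rV[R]_n => x 0 i) (cst ((- y) 0 i))).
    exact: coord_continuous.
  exact: cst_continuous.
apply: continuous_big => [|i _ w]; first exact: add_continuous.
by apply: (@continuousM _ _ (fun x => (x - y) 0 i) (fun x => (x - y) 0 i)); exact: cd.
Qed.

Lemma closed_sqr_dist_ge y (s : R) : closed [set x | s <= edot (x - y) (x - y)].
Proof.
apply: (@preimage_closed _ _ (fun x : 'rV[R]_n => edot (x - y) (x - y)) [set r | s <= r]).
  by move=> x _; exact: continuous_sqr_dist.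
exact: closed_ge.
Qed.

(** At an interior minimum the gradient vanishes and the Laplacian is nonnegative, so the equation
    would give [H 0 >= 0]. The minimum is therefore on the boundary. *)
Lemma solution_ge0 U H eps u :
  open U -> compact (closure U) -> 0 < eps -> H 0 < 0 -> is_solution H eps U u ->
  forall x, closure U x -> 0 <= u x.
Proof.
move=> oU cU e0 H0 [C2u [cu [bu pde]]] x Ux.
have [x0 /set_mem cx0 umin] := compact_EVT_min (ex_intro _ x Ux) cU cu.
apply: le_trans (umin x (mem_set Ux)).
have [Ux0|nUx0] := pselect (U x0); last first.
  by rewrite bu//; exact: bdryP.
have crit i : partial i u x0 = 0 /\ 0 <= partial i (partial i u) x0.
  have [|/eqP + +] := has_partials2_max _ _ _ _ _ oU Ux0
    (has_partials2N _ _ _ _ (Ck_on_has_partials2 _ _ C2u)) _ i.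
    by move=> y Uy; rewrite lerN2; apply: umin; apply/mem_set; exact: subset_closure.
  by rewrite oppr_eq0 oppr_le0 => /eqP.
have := pde x0 Ux0.
have -> : grad u x0 = 0 by apply/rowP => i; rewrite !mxE; case: (crit i).
move=> E; move: H0; rewrite E ltNge => /negP[].
by apply: (mulr_ge0 (ltW e0)); apply: sumr_ge0 => i _; case: (crit i).
Qed.

(* Outside the ball of squared radius [s] around [y], the function
   [M (|x - y|^2 - s)] has gradient of norm at least [2 M rho] and Laplacian
   [2 M n], so superlinearity of [H] makes it a strict supersolution. *)
Lemma solution_le_quadratic H (rho : R) : H2 H -> 0 < rho ->
  exists2 M : R, 0 < M & forall U eps u,
    open U -> compact (closure U) -> 0 < eps < 1 -> is_solution H eps U u ->
    forall y s, rho ^+ 2 <= s -> (forall x, closure U x -> s <= edot (x - y) (x - y)) ->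
    forall x, closure U x -> u x <= M * (edot (x - y) (x - y) - s).
Proof.
move=> HH2 rho0.
(* The slope [n / rho] is the ratio of the Laplacian [2 M n] of the barrier to the lower bound
   [2 M rho] on its gradient; [M] then pushes that gradient beyond [R0]. *)
have [R0 HR0] := HH2 (n%:R / rho).
pose M := (`|R0| + 1) / rho.
have M0 : 0 < M by rewrite divr_gt0// ltr_wpDl.
exists M => // U eps u oU cU /andP[e0 e1] [C2u [cu [bu pde]]] y s rs sU x Ux.
pose v x := M * (edot (x - y) (x - y) - s).
have cv : continuous v.
  move=> w; apply: (@continuousM _ _ (cst M) (fun x => edot (x - y) (x - y) - s)).
    exact: cst_continuous.
  apply: (@continuousB _ _ _ (fun x => edot (x - y) (x - y)) (cst s)).
    exact: continuous_sqr_dist.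
  exact: cst_continuous.
have cuv : {within closure U, continuous (fun x => u x - v x)}.
  by apply: within_continuousB => //; exact: continuous_subspaceT.
have [x0 /set_mem cx0 uvmax] := compact_EVT_max (ex_intro _ x Ux) cU cuv.
rewrite -[M * _]/(v x) -subr_le0.
have /le_trans : u x - v x <= u x0 - v x0 by apply: uvmax; exact/mem_set.
apply; have [Ux0|nUx0] := pselect (U x0); last first.
  rewrite bu ?sub0r ?oppr_le0; last exact: bdryP.
  by apply: (mulr_ge0 (ltW M0)); rewrite subr_ge0 sU.
have crit i : partial i u x0 = M * (2 * (x0 0 i - y 0 i)) /\
    partial i (partial i u) x0 <= M * 2.
  have [|/eqP + +] := has_partials2_max _ _ _ _ _ oU Ux0 (has_partials2B _ _ _ _ _ _ _
    (Ck_on_has_partials2 _ _ C2u)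
    (has_partials2S _ _ _ _ _ (@subsetT _ U) (quadratic_partials2 y M s))) _ i.
    by move=> w Uw; apply: uvmax; apply/mem_set; exact: subset_closure.
  by rewrite subr_eq0 subr_le0 => /eqP.
exfalso.
(* Here [eps < 1] removes [eps] from the bound, so that [M] is independent of it. *)
have lap : eps * laplacian u x0 <= 2 * M * n%:R.
  apply: (@le_trans _ _ (eps * (2 * M * n%:R))).
    have -> : 2 * M * n%:R = \sum_(i < n) M * 2.
      by rewrite sumr_const card_ord -[RHS]mulr_natr (mulrC 2).
    rewrite ler_pM2l//.
    by apply: ler_sum => i _; case: (crit i).
  apply: ler_piMl (ltW e1).
  by apply: mulr_ge0 => //; apply: mulr_ge0 => //; exact: ltW.
have gradE : grad u x0 = (2 * M) *: (x0 - y).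
  by apply/rowP => i; rewrite !mxE (crit i).1; ring.
have gn : 2 * M * rho <= enorm (grad u x0).
  rewrite /enorm gradE edotZl edotZr mulrA -expr2.
  rewrite -[leLHS]ger0_norm; last first.
    by apply: mulr_ge0 (ltW rho0); apply: mulr_ge0 (ltW M0).
  rewrite -sqrtr_sqr ler_wsqrtr// exprMn ler_wpM2l ?sqr_ge0//.
  by rewrite (le_trans rs)// sU.
have Mrho : M * rho = `|R0| + 1 by rewrite /M divfK// gt_eqF.
have gR0 : R0 < enorm (grad u x0).
  rewrite (lt_le_trans _ gn)// -mulrA Mrho.
  have := ler_norm R0; have := normr_ge0 R0; lra.
have g0 : 0 < enorm (grad u x0) by rewrite (lt_le_trans _ gn)// mulr_gt0// mulr_gt0// ltr0n.
have := HR0 _ gR0; rewrite ltr_pdivlMr// pde// => /lt_le_trans/(_ lap).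
rewrite ltNge => /negP; apply.
have -> : 2 * M * n%:R = n%:R / rho * (2 * M * rho) by field; rewrite gt_eqF.
by rewrite ler_wpM2l// divr_ge0// (ltW rho0).
Qed.

End Barriers.

(** * Comparison of a solution with its translates, and the gradient bound *)

Section Translation.
Context {R : realType} {n : nat}.
Implicit Types (x y z h : 'rV[R]_n) (U : set 'rV[R]_n) (u H : 'rV[R]_n -> R).

Lemma continuous_translate h : continuous (fun x => x + h).
Proof.
move=> x; apply: (@continuousD _ _ _ id (cst h)); first exact: cvg_id.
exact: cst_continuous.
Qed.

Lemma within_continuous_translate (A : set 'rV[R]_n) (f : 'rV[R]_n -> R) h :
  {within A, continuous f} ->
  {within [set x | A (x + h)], continuous (fun x => f (x + h))}.
Proof.
move=> /subspace_continuousP cf; apply/subspace_continuousP => x Axh V /(cf _ Axh).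
exact: (continuous_translate h x).
Qed.

Lemma is_derive_exp_coord (c l : R) i j x :
  is_derive x (ebasis R i) (fun x : 'rV[R]_n => c * expR (l * x 0 j))
    (c * l * (j == i)%:R * expR (l * x 0 j)).
Proof.
suff : is_derive (0 *: ebasis R i + x) (ebasis R i)
    (fun x : 'rV[R]_n => c * expR (l * x 0 j)) (c * l * (j == i)%:R * expR (l * x 0 j)).
  by rewrite scale0r add0r.
apply/is_derive_line.
rewrite (_ : (fun s : R => _) =
    (fun s : R => c *: (expR \o (fun s => (l * (j == i)%:R) *: s + l * x 0 j)) s)).
  apply: is_derive_eq; rewrite /GRing.scale /= mulr0 add0r; ring.
by apply/funext => s; rewrite /= !mxE eqxx /= /GRing.scale /=; congr (_ * expR _); ring.
Qed.

Lemma exp_partials2 (c l : R) j :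
  has_partials2 setT (fun x : 'rV[R]_n => c * expR (l * x 0 j))
    (fun i x => c * l * (j == i)%:R * expR (l * x 0 j))
    (fun i x => c * l * (j == i)%:R * l * (j == i)%:R * expR (l * x 0 j)).
Proof. by move=> x _ i; split; exact: is_derive_exp_coord. Qed.

Lemma continuous_exp_coord (c l : R) j :
  continuous (fun x : 'rV[R]_n => c * expR (l * x 0 j)).
Proof.
move=> x; apply: (@continuousM _ _ (cst c) (fun x : 'rV[R]_n => expR (l * x 0 j))).
  exact: cst_continuous.
apply: (@continuous_comp _ _ _ (fun x : 'rV[R]_n => l * x 0 j) expR); last exact: continuous_expR.
apply: (@continuousM _ _ (cst l) (fun x : 'rV[R]_n => x 0 j)); first exact: cst_continuous.
exact: coord_continuous.
Qed.

(* Both [u] and its translate solve the same equation, so their difference has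
   no interior maximum above its boundary values. The locally Lipschitz
   first-order term is absorbed by the perturbation [eta * exp (lambda * x_j)]. *)
Lemma solution_translate_le (j : 'I_n) U H eps u (C : R) :
  open U -> (exists B, forall x, U x -> `|x| <= B) -> 0 < eps -> Ck_on 1 setT H ->
  is_solution H eps U u -> 0 <= C ->
  (forall x, closure U x -> 0 <= u x) ->
  (forall x z, closure U x -> bdry U z -> u x <= C * `|x - z|) ->
  forall x h, closure U x -> closure U (x + h) -> u (x + h) - u x <= C * `|h|.
Proof.
move=> oU [B UB] e0 C1H [C2u [cu [bu pde]]] C0 u0 uC x1 h cx1 cx1h.
rewrite leNgt; apply/negP => gt1.
pose W := closure U `&` [set x | closure U (x + h)].
pose phi x := u (x + h) - u x.
have Wx1 : W x1 by [].
have clW : closed W.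
  apply: closedI; first exact: closed_closure.
  apply: (@preimage_closed _ _ (fun x => x + h)); last exact: closed_closure.
  by move=> x _; exact: continuous_translate.
have cW : compact W.
  by apply: subclosed_compact clW (compact_closure _ _ UB) _ => x [].
have cphi : {within W, continuous phi}.
  apply: within_continuousB.
    apply: (@continuous_subspaceW _ _ _ [set x | closure U (x + h)]); first by move=> x [].
    exact: within_continuous_translate.
  by apply: (@continuous_subspaceW _ _ _ (closure U)) => // x [].
(* Half of the supposed excess at [x1]: the other half leaves room for the perturbation. *)
pose sigma := (phi x1 - C * `|h|) / 2.
have s0 : 0 < sigma by rewrite /sigma divr_gt0// subr_gt0.
pose K := W `&` phi @^-1` [set r | C * `|h| + sigma <= r].
have cK : compact K.
  have clK : closed (phi @^-1` [set r | C * `|h| + sigma <= r] : set (subspace W)).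
    by apply: preimage_closed (@closed_ge _ _) => x _; exact: cphi.
  apply: subclosed_compact cW _ => [|x []//].
  by rewrite /K closed_setSI.
pose V := U `&` [set x | U (x + h)].
(* If [x] is on the boundary, then [u x = 0] and [u (x + h) <= C |h|]; if [x + h] is, then
   [phi x = - u x <= 0]. Neither is compatible with an excess of [sigma]. *)
have KV : K `<=` V.
  move=> x [[cx cxh] /= ge]; split => /=; apply: contrapT => nU.
    have bx : bdry U x by exact: bdryP.
    have := uC _ _ cxh bx; rewrite addrAC subrr add0r.
    by move: ge; rewrite /phi (bu _ bx) subr0; lra.
  have bx : bdry U (x + h) by exact: bdryP.
  have := u0 _ cx; have := normr_ge0 h.
  have : 0 <= C * `|h| by rewrite mulr_ge0.
  by move: ge; rewrite /phi (bu _ bx); lra.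
have oV : open V.
  apply: openI => //; apply: (@open_comp _ _ (fun x => x + h)) => // x _.
  exact: continuous_translate.
have cpu x i : U x -> {for x, continuous (partial i u)}.
  by move=> Ux; have [_ [_ /(_ i) [+ _]]] := C2u; apply.
have [M1 M10 HM1] : exists2 M : R, 0 <= M & forall i x, K x -> `|partial i u x| <= M.
  by apply: compact_family_bound => // i x /KV[Ux _]; exact: cpu.
have [M2 M20 HM2] : exists2 M : R, 0 <= M & forall i x, K x -> `|partial i u (x + h)| <= M.
  apply: (@compact_family_bound _ _ _ _ (fun i x => partial i u (x + h))) => // i x /KV[_ Uxh].
  apply: (@continuous_comp _ _ _ (fun x => x + h) (partial i u)); last exact: cpu.
  exact: continuous_translate.
(* The bounds [M1], [M2] and [L] may depend on [u], [h] and [eps]; they serve only to reach a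
   contradiction and do not enter [C]. *)
have [L L0 HL] := @C1_lipschitz _ _ 1 (fun=> H) (M1 + M2) (fun=> C1H).
(* The exponent makes [eps * l > L], so diffusion of the exponential dominates the first-order
   term. *)
pose l := L / eps + 1.
have l0 : 0 < l by rewrite ltr_wpDl// divr_ge0// ltW.
have el : L < eps * l by rewrite /l mulrDr mulr1 mulrC divfK ?gt_eqF// ltrDl.
(* Since [x_j <= B] on [W], the perturbation is at most [sigma / 2], which keeps the maximum point
   of [psi] in [K]. *)
pose eta := sigma / (2 * expR (l * B)).
have eta0 : 0 < eta by rewrite divr_gt0// mulr_gt0// expR_gt0.
pose psi x := phi x + eta * expR (l * x 0 j).
have cpsi : {within W, continuous psi}.
  apply: within_continuousD => //; apply: continuous_subspaceT.
  exact: continuous_exp_coord.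
have [xm /set_mem Wm psimax] := compact_EVT_max (ex_intro _ x1 Wx1) cW cpsi.
have Km : K xm.
  split => //=.
  have : psi x1 <= psi xm by apply: psimax; exact/mem_set.
  have e1 : 0 < eta * expR (l * x1 0 j) by rewrite mulr_gt0// expR_gt0.
  have em : eta * expR (l * xm 0 j) <= sigma / 2.
    have -> : sigma / 2 = eta * expR (l * B).
      by rewrite /eta; field; rewrite gt_eqF// expR_gt0.
    rewrite ler_pM2l// ler_expR ler_pM2l//.
    rewrite (le_trans (ler_norm _))// (le_trans (coord_le_norm _ _))//.
    by apply: closure_norm_le UB _ _; case: Wm.
  have : phi x1 = C * `|h| + 2 * sigma by rewrite /sigma; field.
  by rewrite /psi; lra.
have [Um Umh] := KV _ Km.
have hp := has_partials2D _ _ _ _ _ _ _ (has_partials2B V _ _ _ _ _ _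
    (has_partials2S _ _ _ _ _ (fun x (Vx : V x) => Vx.2)
       (has_partials2_translate _ _ _ _ h (Ck_on_has_partials2 _ _ C2u)))
    (has_partials2S _ _ _ _ _ (fun x (Vx : V x) => Vx.1) (Ck_on_has_partials2 _ _ C2u)))
  (has_partials2S _ _ _ _ _ (@subsetT _ V) (exp_partials2 eta l j)).
have VW y : V y -> y \in W.
  by move=> [Uy Uyh]; apply/mem_set; split; exact: subset_closure.
have := has_partials2_max _ _ _ _ _ oV (KV _ Km) hp (fun y Vy => psimax y (VW y Vy)).
(* The slope of the perturbation at [xm]: criticality makes the two gradients differ by [- a] in
   direction [j] only, while the Laplacians differ by at most [- a l]. *)
set a := eta * l * expR (l * xm 0 j) => crit.
have a0 : 0 < a by apply: mulr_gt0 (expR_gt0 _); exact: mulr_gt0.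
have gradD i : partial i u (xm + h) - partial i u xm = - (a * (j == i)%:R).
  by have [/eqP + _] := crit i; rewrite addr_eq0 => /eqP ->; rewrite /a; ring.
have lapD : laplacian u (xm + h) - laplacian u xm <= - (a * l).
  have -> : - (a * l) = \sum_i - (a * l * (j == i)%:R).
    rewrite (bigD1 j)//= eqxx mulr1 big1 ?addr0// => i ij.
    by rewrite eq_sym (negbTE ij) mulr0 oppr0.
  rewrite /laplacian -sumrB; apply: ler_sum => i _.
  have [_] := crit i; rewrite -lerBrDr sub0r /a; case: (j == i) => /=.
    rewrite !mulr1 => /le_trans; apply; lra.
  by rewrite !mulr0 !mul0r.
have gB x : (forall i, `|partial i u x| <= M1 + M2) -> `|grad u x| <= M1 + M2.
  by move=> hx; apply: norm_le_coord => [|i]; rewrite ?addr_ge0// mxE.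
have := HL ord0 (grad u (xm + h)) (grad u xm).
rewrite !pde// => /(_ _ _)/wrap[].
- by apply: gB => i; rewrite (le_trans (HM2 i _ Km))// lerDr.
- by apply: gB => i; rewrite (le_trans (HM1 i _ Km))// lerDl.
have -> : \sum_i `|grad u (xm + h) 0 i - grad u xm 0 i| = a.
  rewrite (bigD1 j)//= !mxE gradD eqxx mulr1 normrN gtr0_norm// big1 ?addr0// => i ij.
  by rewrite !mxE gradD eq_sym (negbTE ij) mulr0 oppr0 normr0.
(* The Lipschitz bound limits the drop of [H] to [L a], whereas the equation forces a drop of at
   least [eps a l > L a]. *)
rewrite -mulrBr => /ler_normlP[+ _].
apply/negP; rewrite -ltNge.
apply: (@lt_le_trans _ _ (eps * (a * l))).
  by rewrite [ltRHS](mulrCA eps a l) [ltLHS](mulrC L a) ltr_pM2l.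
by rewrite -mulrN ler_pM2l// lerNr.
Qed.

(** Exchanging the two points makes the one-sided increment bound two-sided; it then bounds the
    difference quotients and passes to their limit. *)
Lemma partial_le_lipschitz U u (C : R) i x :
  0 <= C -> open U -> U x -> derivable u x (ebasis R i) ->
  (forall x h, U x -> U (x + h) -> u (x + h) - u x <= C * `|h|) ->
  `|partial i u x| <= C.
Proof.
move=> C0 oU Ux du uC.
have : \forall t \near 0^', `|t^-1 *: ((u \o shift x) (t *: ebasis R i) - u x)| <= C.
  have C1 : (fun t : R => t *: ebasis R i + x) @ 0 --> (0 *: ebasis R i + x : 'rV[R]_n).
    apply: cvgD; last exact: cvg_cst.
    by apply: cvgZr_tmp; exact: cvg_id.
  rewrite scale0r add0r in C1.
  have : \forall t \near (0 : R), U (t *: ebasis R i + x).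
    by apply: C1; exact: open_nbhs_nbhs.
  move=> /nbhs_ballP[e /= e0 He]; apply/nbhs_ballP; exists e => // t te t0.
  have Ut := He _ te.
  have tn : `|t *: ebasis R i| <= `|t|.
    apply: norm_le_coord => // k; rewrite !mxE eqxx /= normrM.
    by case: (k == i); rewrite ?normr1 ?mulr1// normr0 mulr0.
  rewrite normrZ normfV ler_pdivrMl ?normr_gt0// mulrC.
  apply: (@le_trans _ _ (C * `|t *: ebasis R i|)); last by rewrite ler_wpM2l.
  rewrite ler_norml /= lerNl opprB; apply/andP; split.
    have := uC _ (- (t *: ebasis R i)) Ut; rewrite addrAC subrr add0r normrN; exact.
  by have := uC x (t *: ebasis R i) Ux; rewrite (addrC x); apply.
exact: (cvgr_to_le (cvg_norm du)).
Qed.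

End Translation.

(** * Exterior balls of uniform radius for a smooth bounded domain *)

Section ExteriorBall.
Context {R : realType}.

Lemma edot_row_mx {k l : nat} (a b : 'rV[R]_k) (c d : 'rV[R]_l) :
  edot (row_mx a c) (row_mx b d) = edot a b + edot c d.
Proof.
rewrite /edot big_split_ord /=; congr (_ + _); apply: eq_bigr => i _.
  by rewrite !row_mxEl.
by rewrite !row_mxEr.
Qed.

Lemma sum_norm_le {n : nat} (p : 'rV[R]_n) : \sum_i `|p 0 i| <= n%:R * `|p|.
Proof.
apply: (@le_trans _ _ (\sum_(i < n) `|p|)).
  by apply: ler_sum => i _; exact: coord_le_norm.
by rewrite sumr_const card_ord mulr_natl.
Qed.

Context {m : nat}.
Implicit Types (x z : 'rV[R]_(1 + m)) (U : set 'rV[R]_(1 + m)).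

(* The last condition reads [|x - (z + N)| >= |N|]. *)
Definition exterior_ball U (rho : R) z := exists N : 'rV[R]_(1 + m),
  [/\ rho ^+ 2 <= edot N N, `|N| <= 1 &
      forall x, U x -> 2 * edot (x - z) N <= edot (x - z) (x - z)].

Lemma edot_orthogonal (Q : 'M[R]_(1 + m)) x z : Q *m Q^T = 1%:M ->
  edot (x *m Q) (z *m Q) = edot x z.
Proof. by move=> QQ; rewrite edot_trmx -mulmxA QQ mulmx1. Qed.

Lemma rsubmx_norm_le x : `|rsubmx x| <= `|x|.
Proof. by apply: norm_le_coord => // i; rewrite mxE coord_le_norm. Qed.

(** Inside the chart, a small ball along the outward normal of the graph absorbs the quadratic
    Taylor remainder of [gamma]; outside it, the smallness of [N] suffices. The threshold [d] is the
    same for all [z] near [x0], as the later covering argument requires. *)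
Lemma exterior_ball_graph U x0 (r B : R) (Q : 'M[R]_(1 + m)) (gamma : 'rV[R]_m -> R) :
  0 < r -> Q *m Q^T = 1%:M -> smooth_on setT gamma ->
  (forall x, ball x0 r x -> (U x <->
     (let y := (x - x0) *m Q in lsubmx y 0 0 > gamma (rsubmx y)))) ->
  (forall x, U x -> `|x| <= B) -> `|x0| <= B ->
  exists2 d : R, 0 < d & forall rho z, 0 < rho < d -> `|x0 - z| < r / 2 ->
    `|z| <= B -> ~ U z -> exterior_ball U rho z.
Proof.
move=> r0 QQ sg chart UB x0B.
(* A rotation preserves the Euclidean norm but not the sup norm, hence the detour through a square
   root. *)
pose B' : R := Num.sqrt ((1 + m)%:R * ((B + B) * (B + B))).
pose T x := (x - x0) *m Q.
have TB x : `|x| <= B -> `|rsubmx (T x)| <= B'.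
  move=> xB; rewrite (le_trans (rsubmx_norm_le _))// (le_trans (norm_le_enorm _))//.
  rewrite /enorm edot_orthogonal// ler_wsqrtr// (le_trans (ler_norm _))//.
  rewrite (le_trans (edot_le_norm _ _))// ler_wpM2l//.
  have xx : `|x - x0| <= B + B by rewrite (le_trans (ler_normB _ _))// lerD.
  by rewrite ler_pM.
have [L L0 HL] := C2_taylor1 gamma B' (sg 2).
have [A A0 HA] : exists2 A : R, 0 <= A &
    forall i (y : 'rV[R]_m), `|y| <= B' -> `|partial i gamma y| <= A.
  apply: compact_family_bound; first exact: compact_norm_le.
  by move=> i x _; have [_ [_ /(_ i) [+ _]]] := sg 2; apply.
pose A' := Num.sqrt (1 + m%:R * (A * A)).
have A'0 : 0 <= A' by exact: sqrtr_ge0.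
pose n : R := (1 + m)%:R.
have n0 : 0 <= n by exact: ler0n.
(* The sum collects every requirement on [rho]: [A'] for [|N| <= 1], the term in [L] for the Taylor
   remainder, the last one for points outside the chart. *)
pose S : R := 1 + A' + 2 * L * m%:R ^+ 2 + 2 * n * A'.
have p1 : 0 <= 2 * L * m%:R ^+ 2 by rewrite !mulr_ge0.
have p2 : 0 <= 2 * n * A' by rewrite !mulr_ge0.
have S0 : 0 < S by rewrite /S; lra.
exists (Num.min 1 (r / 2) / S); first by rewrite divr_gt0// lt_min ltr01 divr_gt0.
move=> rho z /andP[rho0]; rewrite ltr_pdivlMr// lt_min => /andP[rS1 rSr] zr zB nUz.
have rhoS (a : R) : a <= S -> rho * a <= rho * S by move=> aS; rewrite ler_pM2l.
have rA : rho * A' <= 1.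
  by apply: le_trans (ltW rS1); apply: rhoS; rewrite /S; lra.
have rL : rho * (2 * L * m%:R ^+ 2) <= 1.
  by apply: le_trans (ltW rS1); apply: rhoS; rewrite /S; lra.
have rn : rho * (2 * n * A') <= r / 2.
  by apply: le_trans (ltW rSr); apply: rhoS; rewrite /S; lra.
pose c := grad gamma (rsubmx (T z)).
(* A downward normal of the graph, left unnormalized: its Euclidean length is at least [1], so
   [rho *: d] has length at least [rho]. *)
pose w : 'rV[R]_(1 + m) := row_mx (-1)%:M c.
pose d := w *m Q^T.
have QQ' : Q^T *m Q^T^T = 1%:M by rewrite trmxK; exact: mulmx1C.
have dd : edot d d = 1 + edot c c.
  rewrite /d edot_orthogonal// edot_row_mx; congr (_ + _).
  by rewrite /edot big_ord1 !mxE mulr1n; ring.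
have cc : edot c c <= m%:R * (A * A).
  rewrite (le_trans (ler_norm _))// (le_trans (edot_le_norm _ _))// ler_wpM2l//.
  have cA : `|c| <= A.
    by apply: norm_le_coord => // i; rewrite mxE; apply/HA/TB.
  by rewrite ler_pM.
have dA : `|d| <= A'.
  by rewrite (le_trans (norm_le_enorm _))// ler_wsqrtr// dd lerD2l.
exists (rho *: d); split.
- rewrite edotZl edotZr mulrA -expr2 ler_peMr ?sqr_ge0// dd lerDl.
  exact: edot_ge0.
- by rewrite normrZ gtr0_norm// (le_trans _ rA)// ler_wpM2l// ltW.
move=> x Ux; rewrite edotZr.
have [xr|xr] := ltP `|x0 - x| r; last first.
  have xz : r / 2 <= `|x - z|.
    by have := ler_distD z x0 x; rewrite (distrC z x); lra.
  apply: le_trans (sqr_norm_le_edot _).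
  have h1 : edot (x - z) d <= n * (`|x - z| * A').
    rewrite (le_trans (ler_norm _))// (le_trans (edot_le_norm _ _))//.
    by rewrite ler_wpM2l// ler_wpM2l.
  have h2 : rho * edot (x - z) d <= rho * (n * (`|x - z| * A')) by rewrite ler_pM2l.
  have h3 : rho * (2 * n * A') * `|x - z| <= `|x - z| * `|x - z|.
    by rewrite ler_wpM2r// (le_trans rn).
  by rewrite expr2; apply: le_trans h3; lra.
have xzT : (x - z) *m Q = T x - T z.
  by rewrite /T -mulmxBl; congr (_ *m _); rewrite opprB addrA subrK.
have Tx : gamma (rsubmx (T x)) < lsubmx (T x) 0 0.
  by apply/(chart x) => //; rewrite -ball_normE.
have Tz : lsubmx (T z) 0 0 <= gamma (rsubmx (T z)).
  rewrite leNgt; apply/negP => h; apply: nUz; apply/(chart z) => //.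
  by rewrite -ball_normE /=; lra.
have HLz := HL _ _ (TB _ (UB _ Ux)) (TB _ zB).
set s := \sum_i _ in HLz; set l1 := \sum_i _ in HLz.
have E : edot (x - z) d = - (lsubmx (T x) 0 0 - lsubmx (T z) 0 0) + s.
  rewrite /d -edot_trmx xzT -[T x - T z]hsubmxK edot_row_mx; congr (_ + _).
    by rewrite /edot big_ord1 !mxE mulr1n; ring.
  by apply: eq_bigr => i _; rewrite !mxE mulrC.
(* As [x] is above the graph and [z] on or below it, the height gained is at least the increment of
   [gamma], and only the Taylor remainder is left. *)
have h1 : edot (x - z) d <= L * l1 ^+ 2.
  by move: HLz => /ler_normlP[+ _]; rewrite E; lra.
have h2 : l1 ^+ 2 <= m%:R ^+ 2 * edot (x - z) (x - z).
  rewrite -(edot_orthogonal Q)// xzT.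
  apply: (@le_trans _ _ ((m%:R * `|T x - T z|) ^+ 2)).
    rewrite ler_sqr ?nnegrE; last 2 first.
    - by apply: sumr_ge0.
    - by rewrite mulr_ge0.
    have -> : l1 = \sum_i `|rsubmx (T x - T z) 0 i|.
      by apply: eq_bigr => i _; rewrite !mxE.
    by rewrite (le_trans (sum_norm_le _))// ler_wpM2l// rsubmx_norm_le.
  by rewrite exprMn ler_wpM2l ?sqr_ge0// sqr_norm_le_edot.
have h3 : L * l1 ^+ 2 <= L * (m%:R ^+ 2 * edot (x - z) (x - z)) by rewrite ler_wpM2l.
have h4 : rho * edot (x - z) d <= rho * (L * (m%:R ^+ 2 * edot (x - z) (x - z))).
  by rewrite ler_pM2l// (le_trans h1).
have h5 : rho * (2 * L * m%:R ^+ 2) * edot (x - z) (x - z) <= 1 * edot (x - z) (x - z).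
  by rewrite ler_wpM2r// edot_ge0.
by rewrite mul1r in h5; apply: le_trans h5; lra.
Qed.

(** Each boundary point has a neighbourhood on which all small [rho] work; compactness of the
    boundary yields one [rho] for all. *)
Lemma uniform_exterior_ball U : smooth_bounded_domain U ->
  exists2 rho : R, 0 < rho & forall z, bdry U z -> exterior_ball U rho z.
Proof.
move=> [oU [_ [_ [[B UB0] chart]]]].
have UB x : U x -> `|x| <= B.
  by move=> /UB0; apply: le_trans; exact: norm_le_enorm.
have cB : compact (bdry U).
  apply: compact_closedI; first exact: compact_closure UB.
  by apply: open_closedC; exact: open_interior.
have nU z : bdry U z -> ~ U z by move=> [_]; rewrite (interior_id U).1.
have bB z : bdry U z -> `|z| <= B by move=> [cz _]; exact: closure_norm_le UB _ cz.
have near_rho : \forall rho \near (0 : R)^'+, bdry U `<=` exterior_ball U rho.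
  move: cB => /compact_near_coveringP/near_covering_withinP; apply => x0 bx0.
  have [r [Q [gamma [r0 [QQ [sg ch]]]]]] := chart _ bx0.
  have [d d0 Hd] := exterior_ball_graph U x0 r B Q gamma r0 QQ sg ch UB (bB _ bx0).
  exists (ball x0 (r / 2), [set rho | 0 < rho < d]).
    split; first by apply: nbhsx_ballx; rewrite divr_gt0.
    near=> rho; apply/andP; split; near: rho; first exact: nbhs_right_gt.
    exact: nbhs_right_lt.
  move=> [z rho] [/= zr rd] bz; apply: Hd => //; last exact: nU.
    by move: zr; rewrite -ball_normE.
  exact: bB.
near (0 : R)^'+ => rho; exists rho; first by near: rho; exact: nbhs_right_gt.
by near: rho.
Unshelve. all: by end_near. Qed.

End ExteriorBall.

(** * The uniform bounds on the solution and its gradient *)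

Theorem theorem3 (R : realType) (m : nat) (U : set 'rV[R]_(1 + m))
  (H : 'rV[R]_(1 + m) -> R) :
  smooth_bounded_domain U -> H1 H -> H2 H -> H3 H ->
  exists C : R, forall (eps : R) (u : 'rV[R]_(1 + m) -> R),
    0 < eps < 1 -> is_solution H eps U u ->
    (forall x, U x -> `|u x| <= C) /\ (forall x, U x -> enorm (grad u x) <= C).
Proof.
move=> sU [sH H0] HH2 _.
have [rho rho0 ext] := uniform_exterior_ball U sU.
have [oU [_ [[a Ua] [[B UB0] _]]]] := sU.
have UB x : U x -> `|x| <= B.
  by move=> /UB0; apply: le_trans; exact: norm_le_enorm.
have cUB := closure_norm_le U B UB.
have cU := compact_closure U B UB.
have B0 : 0 <= B by rewrite (le_trans _ (UB _ Ua)).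
have [M M0 HM] := solution_le_quadratic H rho HH2 rho0.
have [M1 M10 HM1] := solution_le_quadratic H 1 HH2 ltr01.
pose n : R := (1 + m)%:R.
have n0 : 0 <= n by exact: ler0n.
(* The barrier at a boundary point [z] is [M (|x - z|^2 - 2 (x - z).N)]; [2 B] bounds one factor
   [|x - z|] and [2] bounds [2 |N|]. *)
pose C0 := M * (n * (B + B + 2)).
have C00 : 0 <= C0 by rewrite mulr_ge0 ?(ltW M0)// mulr_ge0// !addr_ge0.
pose D := B + (B + 1).
have D0 : 0 <= D by rewrite !addr_ge0.
pose C1 := M1 * (n * (D * D)).
have C10 : 0 <= C1 by rewrite mulr_ge0 ?(ltW M10)// mulr_ge0// mulr_ge0.
exists (C1 + Num.sqrt (n * (C0 * C0))) => eps u eps01 su.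
have [e0 _] := andP eps01.
have u0 := solution_ge0 U H eps u oU cU e0 H0 su.
have uC1 x : closure U x -> u x <= C1.
  (* The unit ball around [y] avoids the interior of the box of radius [B], so a single barrier
     bounds [u] on the whole domain; [D] bounds [|x - y|]. *)
  move=> cx; pose y : 'rV[R]_(1 + m) := (B + 1) *: ebasis R ord0.
  have yB : `|y| <= B + 1.
    apply: norm_le_coord => [|i]; first by rewrite addr_ge0.
    rewrite !mxE eqxx /= normrM (ger0_norm (addr_ge0 B0 ler01)).
    by case: (i == ord0); rewrite ?normr1 ?mulr1// normr0 mulr0 addr_ge0.
  have far w : closure U w -> 1 <= edot (w - y) (w - y).
    move=> cw; apply: le_trans (sqr_norm_le_edot _).
    have w1 : 1 <= `|w - y|.
      apply: le_trans (coord_le_norm _ ord0); rewrite !mxE !eqxx mulr1 distrC.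
      apply: le_trans (ler_norm _).
      have := le_trans (ler_norm _) (le_trans (coord_le_norm w ord0) (cUB _ cw)).
      by lra.
    by rewrite expr2 -[leLHS]mulr1 ler_pM.
  have := HM1 U eps u oU cU eps01 su y 1; rewrite expr1n => /(_ (lexx _) far x cx).
  move=> /le_trans; apply; rewrite ler_pM2l// lerBlDr.
  apply: (@le_trans _ _ (n * (D * D))); last by rewrite lerDl.
  rewrite (le_trans (ler_norm _))// (le_trans (edot_le_norm _ _))// ler_wpM2l//.
  have xyD : `|x - y| <= D by rewrite (le_trans (ler_normB _ _))// lerD// cUB.
  by rewrite ler_pM.
have uC0 x z : closure U x -> bdry U z -> u x <= C0 * `|x - z|.
  move=> cx bz; have [N [rN N1 extN]] := ext z bz.
  have sqE w : edot (w - (z + N)) (w - (z + N)) - edot N N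
      = edot (w - z) (w - z) - 2 * edot (w - z) N.
    rewrite opprD addrA; move: (w - z) => v.
    by rewrite edotDl !edotDr !edotNl !edotNr (edotC N v); ring.
  (* By [sqE] the exterior ball condition says exactly this on [U]; it extends to the closure
     because the condition is closed. *)
  have far w : closure U w -> edot N N <= edot (w - (z + N)) (w - (z + N)).
    move=> cw; set y := z + N.
    have /closureS/(_ w cw) : U `<=` [set w | edot N N <= edot (w - y) (w - y)].
      by move=> v Uv /=; rewrite -subr_ge0 sqE subr_ge0 extN.
    by have /closure_id <- := closed_sqr_dist_ge y (edot N N).
  have := HM U eps u oU cU eps01 su (z + N) _ rN far x cx; rewrite sqE.
  move=> /le_trans; apply; rewrite /C0 -mulrA ler_pM2l//.
  have h1 := le_trans (ler_norm _) (edot_le_norm (x - z) (x - z)).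
  have h2 := edot_le_norm (x - z) N; rewrite ler_norml in h2.
  have h3 : `|x - z| <= B + B.
    by rewrite (le_trans (ler_normB _ _))// lerD// cUB//; case: bz.
  have h4 : n * (`|x - z| * `|x - z|) <= n * (`|x - z| * (B + B)).
    by rewrite ler_wpM2l// ler_wpM2l.
  have h5 : n * (`|x - z| * `|N|) <= n * (`|x - z| * 1).
    by rewrite ler_wpM2l// ler_wpM2l.
  by move: h2 => /andP[h2 _]; rewrite -/n in h1 h2; lra.
have C1H : Ck_on 1 setT H by exact: sH.
have lip := solution_translate_le ord0 U H eps u C0 oU (ex_intro _ B UB) e0 C1H su C00 u0 uC0.
split=> x Ux.
  have cx := subset_closure Ux.
  rewrite ger0_norm ?u0// (le_trans (uC1 _ cx))// lerDl sqrtr_ge0//.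
rewrite (@le_trans _ _ (Num.sqrt (n * (C0 * C0))))//; last by rewrite lerDr.
rewrite ler_wsqrtr// (le_trans (ler_norm _))// (le_trans (edot_le_norm _ _))//.
(* The Lipschitz estimate bounds each entry of the gradient; the factor [n] under the root converts
   this to the Euclidean norm. *)
have gC : `|grad u x| <= C0.
  apply: norm_le_coord => // i; rewrite mxE.
  apply: (partial_le_lipschitz U) => //.
    by have [[_ [du _]] _] := su; exact: du.
  by move=> v h Uv Uvh; apply: lip; exact: subset_closure.
by rewrite ler_wpM2l// ler_pM.
Qed.
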